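(* Let $(S,\cdot,+,-)$ be a localisable semigroup. Then there is a unary operation ${}^{*}$ on $S$ such that $(S,\cdot,{}^{*})$ is a $*$-localisable semigroup with $x^{+}=xx^{*}$ and $x^{-}=x^{*}x$ for all $x\in S$ if and only if the transcription category $\mathscr{C}(S)$ is a transcription groupoid.
   Context: A semigroup $S$ with a unary operation ${}^{*}$, written $(S,\cdot,{}^{*})$, is $*$-localisable if for all $x,y\in S$: (a) $xx^{*}x=x$; (b) $x^{*}xx^{*}=x^{*}$; (c) $(x(xx)^{*}x)^{*}=x(xx)^{*}x$; (d) $x(xyy^{*})^{*}=xy(xy)^{*}$; (e) $(x^{*}xy)^{*}y=(xy)^{*}xy$. Such a semigroup is regarded as a localisable semigroup with projections $x^{+}=xx^{*}$ and $x^{-}=x^{*}x$. A localisable semigroup is an algebra $(S,\cdot,+,-)$ of signature $(2,1,1)$ such that $(S,\cdot)$ is a semigroup and for all $x,y\in S$: (a) $x^{+}x=x$; (b) $(xy)^{+}=(xy^{+})^{+}$; (c) $x^{+}y^{+}=(x^{+}y)^{+}$; (d) $xx^{-}=x$; (e) $(xy)^{-}=(x^{-}y)^{-}$; (f) $x^{-}y^{-}=(xy^{-})^{-}$; (g) $(x^{+})^{-}=x^{+}$ and $(x^{-})^{+}=x^{-}$. We write $S^{+}=\{x^{+}:x\in S\}=\{x^{-}:x\in S\}$. For a localisable semigroup $S$, $\mathscr{C}(S)=(S,\circ,+,-)$ is the small category with set of arrows $S$, in which the trace product $x\circ y$ is defined exactly when $x^{-}=y^{+}$ and then $x\circ y=x\cdot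 y$; its identities are the elements of $S^{+}$, with $x^{+}\circ x=x=x\circ x^{-}$. Together with the transcription maps ${}_{e}|x=e\cdot x$ and $x|_{f}=x\cdot f$ ($x\in S$, $e,f\in S^{+}$) it is what is called a transcription category. A transcription groupoid is a transcription category whose underlying category is a groupoid, i.e. every arrow $x$ has an inverse arrow $x^{-1}$ with $x\circ x^{-1}=x^{+}$ and $x^{-1}\circ x=x^{-}$. *)

(* Defs.v *)
From mathcomp Require Import ssreflect ssrfun.

Set Implicit Arguments.
Unset Strict Implicit.
Unset Printing Implicit Defensive.

Declare Scope loc_scope.

Section Semigroups.
Variables (S : Type) (mul : S -> S -> S).
Local Notation "x * y" := (mul x y) : loc_scope.
Local Open Scope loc_scope.

Record localisable (plus minus : S -> S) : Prop := Localisable {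
  loc_mulA : associative mul;
  loc_plus_mul : forall x, plus x * x = x;
  loc_plusM : forall x y, plus (x * y) = plus (x * plus y);
  loc_plus_plus : forall x y, plus x * plus y = plus (plus x * y);
  loc_mul_minus : forall x, x * minus x = x;
  loc_minusM : forall x y, minus (x * y) = minus (minus x * y);
  loc_minus_minus : forall x y, minus x * minus y = minus (x * minus y);
  loc_minusP : forall x, minus (plus x) = plus x;
  loc_plusN : forall x, plus (minus x) = minus x
}.

Record star_localisable (star : S -> S) : Prop := StarLocalisable {
  star_mulA : associative mul;
  star_mulVK : forall x, x * star x * x = x;
  star_mulKV : forall x, star x * x * star x = star x;
  star_idem : forall x, star (x * star (x * x) * x) = x * star (x * x) * x;
  star_left : forall x y,
    x * star (x * y * star y) = x * y * star (x * y);
  star_right : forall x y,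
    star (star x * x * y) * y = star (x * y) * (x * y)
}.

End Semigroups.

(* One-sorted small categories. Composition is in diagrammatic order:
   [comp x y _] is defined when [cod x = dom y]. *)
Record small_category := SmallCategory {
  arr : Type;
  dom : arr -> arr;
  cod : arr -> arr;
  comp : forall x y, cod x = dom y -> arr;
  cod_dom : forall x, cod (dom x) = dom x;
  dom_cod : forall x, dom (cod x) = cod x;
  dom_comp : forall x y (h : cod x = dom y), dom (comp h) = dom x;
  cod_comp : forall x y (h : cod x = dom y), cod (comp h) = cod y;
  comp_dom : forall x (h : cod (dom x) = dom x), comp h = x;
  comp_cod : forall x (h : cod x = dom (cod x)), comp h = x;
  compA : forall x y z (hxy : cod x = dom y) (hyz : cod y = dom z)
    (hl : cod (comp hxy) = dom z) (hr : cod x = dom (comp hyz)),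
    comp hl = comp hr
}.

Definition is_identity (C : small_category) (e : arr C) : Prop :=
  exists x, e = dom x.

Definition is_groupoid (C : small_category) : Prop :=
  forall x : arr C, exists (y : arr C) (h : cod x = dom y) (h' : cod y = dom x),
    comp h = dom x /\ comp h' = cod x.

(* [ltr e _ x] is the left transcription e|x and [rtr x f _] the right
   transcription x|f. The laws are those under which the pseudo-product
   (x | dom y) o (cod x | y) makes the arrows a localisable semigroup. The
   proof arguments in [ltr_tr], [rtr_tr], [ltr_comp] and [rtr_comp] can always
   be supplied: by [dom_ltr], [ltr_id] and [cod_rtr] the identities are closed
   under transcription, and, e.g., cod (e|x) = cod ((e|x)|(cod x))
   = cod (e|x) | cod x = dom (cod (e|x) | y) when cod x = dom y. *)
Record transcription_category := TranscriptionCategory {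
  tr_cat :> small_category;
  ltr : forall e : arr tr_cat, is_identity e -> arr tr_cat -> arr tr_cat;
  rtr : arr tr_cat -> forall f : arr tr_cat, is_identity f -> arr tr_cat;
  dom_ltr : forall e (he : is_identity e) x, dom (ltr he x) = ltr he (dom x);
  cod_rtr : forall x f (hf : is_identity f), cod (rtr x hf) = rtr (cod x) hf;
  ltr_id : forall e f (he : is_identity e) (hf : is_identity f),
    ltr he f = rtr e hf;
  ltr_dom : forall x (h : is_identity (dom x)), ltr h x = x;
  rtr_cod : forall x (h : is_identity (cod x)), rtr x h = x;
  ltr_tr : forall e f (he : is_identity e) (hf : is_identity f)
    (hef : is_identity (ltr he f)) x, ltr hef x = ltr he (ltr hf x);
  rtr_tr : forall x e f (he : is_identity e) (hf : is_identity f)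
    (hef : is_identity (rtr e hf)), rtr x hef = rtr (rtr x he) hf;
  ltr_rtr : forall e x f (he : is_identity e) (hf : is_identity f),
    rtr (ltr he x) hf = ltr he (rtr x hf);
  ltr_comp : forall e (he : is_identity e) x y (h : cod x = dom y)
    (hc : is_identity (cod (ltr he x)))
    (h' : cod (ltr he x) = dom (ltr hc y)),
    ltr he (comp h) = comp h';
  rtr_comp : forall x y f (hf : is_identity f) (h : cod x = dom y)
    (hd : is_identity (dom (rtr y hf)))
    (h' : cod (rtr x hd) = dom (rtr y hf)),
    rtr (comp h) hf = comp h'
}.

Definition is_transcription_groupoid (T : transcription_category) : Prop :=
  is_groupoid (tr_cat T).

Section TraceCategory.
Variables (S : Type) (mul : S -> S -> S) (plus minus : S -> S).
Hypothesis hS : localisable mul plus minus.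
Local Notation "x * y" := (mul x y) : loc_scope.
Local Open Scope loc_scope.

Let mulA := loc_mulA hS.

Lemma trace_dom x y : minus x = plus y -> plus (x * y) = plus x.
Proof. by move=> h; rewrite (loc_plusM hS) -h (loc_mul_minus hS). Qed.

Lemma trace_cod x y : minus x = plus y -> minus (x * y) = minus y.
Proof. by move=> h; rewrite (loc_minusM hS) h (loc_plus_mul hS). Qed.

Lemma mul_cod x : minus x = plus (minus x) -> x * minus x = x.
Proof. by rewrite (loc_mul_minus hS). Qed.

Lemma mul_dom x : minus (plus x) = plus x -> plus x * x = x.
Proof. by rewrite (loc_plus_mul hS). Qed.

Definition trace_category : small_category :=
  @SmallCategory S plus minus (fun x y _ => x * y)
    (loc_minusP hS) (loc_plusN hS) trace_dom trace_cod mul_dom mul_cod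
    (fun x y z _ _ _ _ => esym (mulA x y z)).

Local Notation is_id := (@is_identity trace_category).

Lemma plus_id e : is_id e -> plus e = e.
Proof. by case=> x -> /=; rewrite -(loc_minusP hS x) (loc_plusN hS). Qed.

Lemma minus_id e : is_id e -> minus e = e.
Proof. by case=> x ->; exact: (loc_minusP hS). Qed.

Lemma plus_mul_id e x : is_id e -> plus (e * x) = e * plus x.
Proof. by move=> /plus_id he; rewrite -{1}he -(loc_plus_plus hS) he. Qed.

Lemma minus_mul_id x f : is_id f -> minus (x * f) = minus x * f.
Proof. by move=> /minus_id hf; rewrite -{1}hf -(loc_minus_minus hS) hf. Qed.

Lemma trace_ltr_comp e x y : is_id e -> minus x = plus y ->
  e * (x * y) = (e * x) * (minus (e * x) * y).
Proof. by move=> _ _; rewrite [RHS]mulA (loc_mul_minus hS) mulA. Qed.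

Lemma trace_rtr_comp x y f : is_id f -> minus x = plus y ->
  (x * y) * f = (x * plus (y * f)) * (y * f).
Proof. by move=> _ _; rewrite -[RHS]mulA (loc_plus_mul hS) mulA. Qed.

(* The category C(S). *)
Definition transcription_of : transcription_category :=
  @TranscriptionCategory trace_category
    (fun e _ x => e * x) (fun x f _ => x * f)
    (fun e he x => plus_mul_id x he)
    (fun x f hf => minus_mul_id x hf)
    (fun _ _ _ _ => erefl)
    (fun x _ => loc_plus_mul hS x)
    (fun x _ => loc_mul_minus hS x)
    (fun e f _ _ _ x => esym (mulA e f x))
    (fun x e f _ _ _ => mulA x e f)
    (fun e x f _ _ => esym (mulA e x f))
    (fun e he x y h _ _ => trace_ltr_comp he h)
    (fun x y f hf h _ _ => trace_rtr_comp hf h).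

End TraceCategory.

(* Main.v *)
From mathcomp Require Import ssreflect ssrfun.
From Stdlib Require Import IndefiniteDescription.
Require Import Defs.

(** Both sides say that every [x] has a [y] which is at once an inverse arrow
    of [x] in the trace category and the value of [*] at [x].

    Given [*], the equations [x x* = x^+] and [x* x = x^-] hold by hypothesis,
    so only composability is at stake: [x* = x* x x*] absorbs [x^+] on the
    right and [x^-] on the left, and the localisable laws then give
    [(x* )^+ = x^-] and [(x* )^- = x^+].

    Given a groupoid, let [x*] be the inverse arrow. Axioms (a) and (b) are
    groupoid identities. Axioms (d) and (e) hold because, for [u = x y^+], the
    inverse [u*] absorbs [u^- = x^- y^+] on its left, so that
    [x u* = u u* = u^+ = (x y)^+]; the other side is dual. The least formal
    axiom is (c): the element [x (x x)* x] is plainly idempotent, and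
    [idem_plus] shows that, when arrows are invertible, every idempotent is a
    projection; projections are identity arrows, hence their own inverses. *)

Section TraceInverse.
Variables (S : Type) (mul : S -> S -> S) (plus minus : S -> S).
Hypothesis hS : localisable mul plus minus.
Local Notation "x * y" := (mul x y) : loc_scope.
Local Open Scope loc_scope.

Let mulA := loc_mulA hS.
Let plusK := loc_plus_mul hS.
Let minusK := loc_mul_minus hS.

Record trace_inverse (x y : S) : Prop := TraceInverse {
  inv_cod : minus x = plus y;
  inv_dom : minus y = plus x;
  inv_mulr : x * y = plus x;
  inv_mull : y * x = minus x
}.

Lemma groupoid_trace_inverse :
  is_transcription_groupoid (transcription_of hS) <->
  forall x, exists y, trace_inverse x y.
Proof.
split=> H x.
- by have [y [h [h' [e e']]]] := H x; exists y; split.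
- by have [y [h h' e e']] := H x; exists y, h, h'.
Qed.

(** Composability comes for free from the two product equations once [y]
    reproduces itself in [y x y]: then [y = y x^+ = x^- y], and moving [^+]
    and [^-] through these products leaves a projection. *)
Lemma trace_inverse_of_mul x y :
  y * x * y = y -> x * y = plus x -> y * x = minus x -> trace_inverse x y.
Proof.
move=> yxy xy yx; split=> //.
- by rewrite -yxy -mulA xy -(loc_plusM hS) yx (loc_plusN hS).
- by rewrite -yxy yx -(loc_minusM hS) xy (loc_minusP hS).
Qed.

Lemma plus_plus x : plus (plus x) = plus x.
Proof. by rewrite -{1}(loc_minusP hS x) (loc_plusN hS) (loc_minusP hS). Qed.

(** Cancelling an idempotent [z] with its inverse gives [z^+ = z z^+] and
    [z^- = z^- z]. Taking [^-] of the former and [^+] of the latter yields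
    [z^+ = z^- z^+ = z^-], so [z = z z^- = z z^+ = z^+]. *)
Lemma idem_plus z z' : trace_inverse z z' -> z * z = z -> z = plus z.
Proof.
move=> [_ _ zz' z'z] zz.
have zP : z * plus z = plus z by rewrite -zz' mulA zz.
have Nz : minus z * z = minus z by rewrite -z'z -mulA zz.
have NP : minus z * plus z = plus z.
  by rewrite -{1}(loc_minusP hS z) (loc_minus_minus hS) (loc_minusP hS) zP
    (loc_minusP hS).
have PN : minus z * plus z = minus z.
  by rewrite -{1}(loc_plusN hS z) (loc_plus_plus hS) (loc_plusN hS) Nz
    (loc_plusN hS).
by rewrite -{1}(minusK z) -PN NP.
Qed.

Lemma trace_inverse_plus x y : trace_inverse (plus x) y -> y = plus x.
Proof.
move=> [cod_y _ xy _].
by rewrite -{1}(plusK y) -cod_y (loc_minusP hS) xy plus_plus.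
Qed.

(** Since [v] absorbs [(x y^+)^- = x^- y^+] on its left, the missing factor
    [y^+] between [x] and [v] may be inserted. *)
Lemma mul_inv_left x y v : trace_inverse (x * plus y) v -> x * v = plus (x * y).
Proof.
move=> [cod_v _ uv _].
have cod_u : minus (x * plus y) = minus x * plus y.
  by rewrite -(loc_minusP hS y) -(loc_minus_minus hS).
by rewrite -{1}(plusK v) -cod_v cod_u !mulA minusK uv -(loc_plusM hS).
Qed.

Lemma mul_inv_right x y v :
  trace_inverse (minus x * y) v -> v * y = minus (x * y).
Proof.
move=> [_ dom_v _ vu].
have dom_u : plus (minus x * y) = minus x * plus y.
  by rewrite -(loc_plusN hS x) -(loc_plus_plus hS).
by rewrite -{1}(minusK v) dom_v dom_u -!mulA plusK vu -(loc_minusM hS).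
Qed.

Lemma trace_inverse_star_localisable (star : S -> S) :
  (forall x, trace_inverse x (star x)) -> star_localisable mul star.
Proof.
move=> H.
have xV x : x * star x = plus x by case: (H x).
have Vx x : star x * x = minus x by case: (H x).
split=> // [x|x|x|x y|x y].
- by rewrite xV plusK.
- by rewrite Vx (inv_cod _ _ (H x)) plusK.
- set w := x * x; set z := x * star w * x.
  have zz : z * z = z.
    (* The inner factor of [z z] is [w* w w*], since [w = x x]. *)
    have -> : z * z = x * (star w * w * star w) * x by rewrite /z /w !mulA.
    by rewrite Vx (inv_cod _ _ (H w)) plusK.
  have zP := idem_plus _ _ (H z) zz.
  by rewrite {2}zP; apply: trace_inverse_plus; rewrite -zP; exact: H.
- by rewrite -mulA !xV; apply: mul_inv_left; exact: H.
- by rewrite !Vx; apply: mul_inv_right; exact: H.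
Qed.

End TraceInverse.

Theorem corollary8p6 (S : Type) (mul : S -> S -> S) (plus minus : S -> S)
    (hS : localisable mul plus minus) :
  (exists star : S -> S,
      star_localisable mul star /\
      forall x : S, plus x = mul x (star x) /\ minus x = mul (star x) x)
  <-> is_transcription_groupoid (transcription_of hS).
Proof.
rewrite groupoid_trace_inverse; split.
- move=> [star [hstar proj]] x; have [px mx] := proj x.
  by exists (star x); apply: (trace_inverse_of_mul _ _ _ _ hS) => //;
    exact: (star_mulKV hstar).
- move=> /functional_choice[star H]; exists star; split.
    exact: (trace_inverse_star_localisable _ _ _ _ hS).
  by move=> x; case: (H x).
Qed.
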